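(* Let $(G,T,\ell,u,w)$ be a PESP instance with $G=(V,A)$, let $\Gamma$ be the cycle matrix of an integral cycle basis $B$ of $G$, and let $\mathcal P$ be the fractional periodic timetabling polytope, with its inequality description $\Gamma x - Tz\le 0$, $-\Gamma x+Tz\le 0$, $x\le u$, $-x\le -\ell$, continuous variables $x\in\mathbb R^A$ and integer variables $z\in\mathbb Z^B$. Then every flip inequality with $\alpha_{\gamma,F}\neq 0$ is a split inequality for this mixed-integer formulation, and vice versa. That is: for every $\gamma\in\mathcal C$ and $F\subseteq A$ with $\alpha_{\gamma,F}\ne 0$ there is $\lambda\in\Lambda$ such that, modulo the equations $\Gamma x=Tz$, the flip inequality for $(\gamma,F)$ is a positive multiple of the split inequality for $\lambda$; and conversely for every $\lambda\in\Lambda$ there are $\gamma\in\mathcal C$ and $F\subseteq A$ with $\alpha_{\gamma,F}\neq 0$ such that, modulo the equations $\Gamma x=Tz$, the split inequality for $\lambda$ is a positive multiple of the flip inequality for $(\gamma,F)$. In particular, $\mathcal P_{\mathrm{split}}=\mathcal P_{\mathrm{flip}}$.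
   Context: PESP. A PESP instance $(G,T,\ell,u,w)$ consists of a finite weakly connected directed graph $G=(V,A)$, a period $T\in\mathbb N$, $T\ge 2$, bounds $\ell,u\in\mathbb Z^A$ and weights $w\in\mathbb R^A$. The cycle space is $\mathcal C=\{\gamma\in\mathbb Z^A \mid \sum_{a\in\delta^+(i)}\gamma_a=\sum_{a\in\delta^-(i)}\gamma_a\ \forall i\in V\}$, a free abelian group of rank $\mu=|A|-|V|+1$. An oriented cycle is an element of $\mathcal C\cap\{-1,0,1\}^A$. An integral cycle basis is a set $B$ of $\mu$ oriented cycles forming a $\mathbb Z$-basis of $\mathcal C$; its cycle matrix $\Gamma\in\{-1,0,1\}^{B\times A}$ has the elements of $B$ as rows. The fractional periodic timetabling polytope is $\mathcal P=\{(x,z)\in\mathbb R^A\times\mathbb R^B\mid \Gamma x=Tz,\ \ell\le x\le u\}$. Flip inequalities. $[y]_T\in[0,T)$ denotes $y$ modulo $T$. For $\gamma\in\mathcal C$, $F\subseteq A$ set $\alpha=\alpha_{\gamma,F}=[-\sum_{a\in A\setminus F}\gamma_a\ell_a-\sum_{a\in F}\gamma_a u_a]_T$. The flip inequality for $(\gamma,F)$ is $$(T-\alpha)\sum_{a\in A\setminus F,\gamma_a>0}\gamma_a(x_a-\ell_a)+\alpha\sum_{a\in A\setminus F,\gamma_a<0}(-\gamma_a)(x_a-\ell_a)+\alpha\sum_{a\in F,\gamma_a>0}\gamma_a(u_a-x_a)+(T-\alpha)\sum_{a\in F,\gamma_a<0}(-\gamma_a)(u_a-x_a)\ \ge\ \alpha(T-\alpha).$$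 $\mathcal P_{\mathrm{flip}}$ is the set of $(x,z)\in\mathcal P$ satisfying the flip inequality for all $\gamma\in\mathcal C$, $F\subseteq A$. Split inequalities. For a polyhedron $P=\{(x,z)\in\mathbb R^n\times\mathbb R^p\mid A_Cx+A_Iz\le b\}$ with $m$ rows and rational data, where $z$ are the integer variables, the split closure is $P_{\mathrm{split}}=\bigcap_{\beta\in\mathbb Z^p}\operatorname{conv}\{(x,z)\in P\mid\beta^\top z\in\mathbb Z\}$. Let $\Lambda$ be the set of $\lambda\in\mathbb R^m$ with $\lambda^\top A_C=0$, $\lambda^\top A_I\in\mathbb Z^p$, $\lambda^\top b\notin\mathbb Z$, and such that the rows of $(A_C\ A_I)$ corresponding to non-zero entries of $\lambda$ are linearly independent. With $\lambda_+=\max(\lambda,0)$, $\lambda_-=\max(-\lambda,0)$ componentwise and $[\cdot]_1$ the fractional part in $[0,1)$, the split inequality for $\lambda\in\Lambda$ is $$\frac{\lambda_+^\top(b-A_Cx-A_Iz)}{[\lambda^\top b]_1}+\frac{\lambda_-^\top(b-A_Cx-A_Iz)}{1-[\lambda^\top b]_1}\ge 1.$$ One has $P_{\mathrm{split}}=\{(x,z)\in P\mid (x,z)\text{ satisfies the split inequality for all }\lambda\in\Lambda\}$. *)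

(* Defs.v *)
From mathcomp Require Import all_boot all_order all_algebra.
From mathcomp Require Import boolp classical_sets reals convex.

Set Implicit Arguments.
Unset Strict Implicit.
Unset Printing Implicit Defensive.

Import Order.TTheory GRing.Theory Num.Theory.

Local Open Scope classical_set_scope.
Local Open Scope ring_scope.

(** * Convex hulls, linear inequalities and fractional parts *)

Definition convex_hull (R : realType) (E : lmodType R) (X : set E) : set E :=
  smallest (@convex_set R E) X.

Definition fracpart (R : realType) (y : R) : R := y - (Num.floor y)%:~R.

(* The points (x, z) of a mixed-integer formulation; the vectors are finite
   functions, so that coordinates can be indexed by arbitrary finite types.
   R^o is R seen as a module over itself. *)
Notation mixed_point R N P := ({ffun N -> R^o} * {ffun P -> R^o})%type.

(* The inequality [ineq_lhs p >= ineq_rhs] in the unknown p. *)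
Record ineq (R : realType) (E : Type) := Ineq {
  ineq_lhs : E -> R;
  ineq_rhs : R }.

Definition satisfies (R : realType) (E : Type) (q : ineq R E) (p : E) : Prop :=
  ineq_rhs q <= ineq_lhs q p.

(* q1 is obtained from q2 by multiplying both sides by some c > 0, where two
   left-hand sides are identified when they agree on the solution set S of the
   equations under consideration. *)
Definition positive_multiple (R : realType) (E : Type) (S : set E)
    (q1 q2 : ineq R E) : Prop :=
  exists2 c : R, 0 < c &
    ineq_rhs q1 = c * ineq_rhs q2 /\
    (forall p, S p -> ineq_lhs q1 p = c * ineq_lhs q2 p).

(** * Mixed-integer formulations A_C x + A_I z <= b and split inequalities *)

Record mip (R : realType) := Mip {
  mip_row : finType;
  mip_cvar : finType;
  mip_ivar : finType;
  mip_AC : mip_row -> mip_cvar -> R;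
  mip_AI : mip_row -> mip_ivar -> R;
  mip_b : mip_row -> R }.

Section Split.
Variables (R : realType) (S : mip R).

Local Notation mip_point := (mixed_point R (mip_cvar S) (mip_ivar S)).

Definition mip_slack (p : mip_point) (i : mip_row S) : R :=
  mip_b i - \sum_j mip_AC i j * p.1 j - \sum_j mip_AI i j * p.2 j.

Definition mip_polyhedron : set mip_point :=
  [set p : mip_point |
    forall i : mip_row S, \sum_j mip_AC i j * p.1 j + \sum_j mip_AI i j * p.2 j <= mip_b i].

Definition split_closure : set mip_point :=
  \bigcap_(beta in [set: {ffun mip_ivar S -> int}])
    convex_hull [set p : mip_point | mip_polyhedron p /\
                                     \sum_j (beta j)%:~R * p.2 j \is a Num.int].

Definition mip_rowvec (i : mip_row S) : mip_point :=
  ([ffun j => mip_AC i j], [ffun j => mip_AI i j]).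

Definition split_rhs (lambda : {ffun mip_row S -> R}) : R :=
  \sum_i lambda i * mip_b i.

(* [free] is linear independence of the sequence of rows as a family:
   two equal rows are dependent. *)
Definition split_multiplier (lambda : {ffun mip_row S -> R}) : Prop :=
  [/\ forall j, \sum_i lambda i * mip_AC i j = 0,
      forall j, \sum_i lambda i * mip_AI i j \is a Num.int,
      split_rhs lambda \isn't a Num.int &
      free [seq mip_rowvec i | i <- enum (mip_row S) & lambda i != 0]].

Definition split_ineq (lambda : {ffun mip_row S -> R}) : ineq R mip_point :=
  Ineq (fun p : mip_point =>
    (\sum_i Num.max (lambda i) 0 * mip_slack p i) / fracpart (split_rhs lambda)
    + (\sum_i Num.max (- lambda i) 0 * mip_slack p i)
      / (1 - fracpart (split_rhs lambda))) 1.

End Split.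

Arguments mip_slack {R} S p i.
Arguments mip_polyhedron {R} S p.
Arguments split_closure {R} S p.
Arguments mip_rowvec {R} S i.
Arguments split_rhs {R} S lambda.
Arguments split_multiplier {R} S lambda.
Arguments split_ineq {R} S lambda.

(** * Directed graphs and their cycle spaces *)

(* Parallel arcs and loops are allowed. *)
Record digraph := Digraph {
  dvertex : finType;
  darc : finType;
  src : darc -> dvertex;
  tgt : darc -> dvertex }.

Definition adjacent (G : digraph) : rel (dvertex G) :=
  [rel i j | [exists a : darc G, ((src a == i) && (tgt a == j))
                             || ((src a == j) && (tgt a == i))]].

Definition weakly_connected (G : digraph) : Prop :=
  (0 < #|dvertex G|)%N /\ (forall i j, connect (@adjacent G) i j).

Definition cycle_space (G : digraph) (gamma : {ffun darc G -> int}) : Prop :=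
  forall i : dvertex G,
    \sum_(a | src a == i) gamma a = \sum_(a | tgt a == i) gamma a.

Definition oriented_cycle (G : digraph) (gamma : {ffun darc G -> int}) : Prop :=
  cycle_space gamma /\ (forall a, gamma a \in [:: -1; 0; 1]).

(* |A| - |V| + 1; the truncated subtraction is harmless, because
   |V| <= |A| + 1 holds in a weakly connected graph. *)
Definition cyclomatic (G : digraph) : nat := (#|darc G| + 1 - #|dvertex G|)%N.

(* Gamma lists the rows of the cycle matrix, i.e. the elements of the basis. *)
Definition integral_cycle_basis (G : digraph)
    (Gamma : 'I_(cyclomatic G) -> {ffun darc G -> int}) : Prop :=
  (forall k, oriented_cycle (Gamma k)) /\
  (forall gamma, cycle_space gamma ->
     exists! c : {ffun 'I_(cyclomatic G) -> int},
       forall a, gamma a = \sum_k c k * Gamma k a).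

(** * Periodic timetabling *)

Record pesp (R : realType) := Pesp {
  pesp_graph :> digraph;
  period : nat;
  lower : {ffun darc pesp_graph -> int};
  upper : {ffun darc pesp_graph -> int};
  weight : {ffun darc pesp_graph -> R};
  pesp_connected : weakly_connected pesp_graph;
  period_ge2 : (2 <= period)%N }.

Section Timetabling.
Variables (R : realType) (I : pesp R).
Variable Gamma : 'I_(cyclomatic I) -> {ffun darc I -> int}.

Local Notation T := (period I).
Local Notation l a := (lower I a).
Local Notation u a := (upper I a).

Local Notation pesp_point := (mixed_point R (darc I) 'I_(cyclomatic I)).

Definition cycle_periodic : set pesp_point :=
  [set p : pesp_point | forall k, \sum_a (Gamma k a)%:~R * p.1 a = T%:R * p.2 k].

Definition fractional_polytope : set pesp_point :=
  [set p : pesp_point | cycle_periodic p /\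
           (forall a, (l a)%:~R <= p.1 a /\ p.1 a <= (u a)%:~R)].

Definition flip_alpha (gamma : {ffun darc I -> int}) (F : {set darc I}) : int :=
  ((- (\sum_(a in ~: F) gamma a * l a) - \sum_(a in F) gamma a * u a)
     %% T%:Z)%Z.

Definition flip_ineq (gamma : {ffun darc I -> int}) (F : {set darc I}) :
    ineq R pesp_point :=
  let alpha : R := (flip_alpha gamma F)%:~R in
  let g a : R := (gamma a)%:~R in
  Ineq (fun p : pesp_point =>
      (T%:R - alpha) * (\sum_(a in ~: F | 0 < gamma a) g a * (p.1 a - (l a)%:~R))
    + alpha * (\sum_(a in ~: F | gamma a < 0) (- g a) * (p.1 a - (l a)%:~R))
    + alpha * (\sum_(a in F | 0 < gamma a) g a * ((u a)%:~R - p.1 a))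
    + (T%:R - alpha) * (\sum_(a in F | gamma a < 0) (- g a) * ((u a)%:~R - p.1 a)))
    (alpha * (T%:R - alpha)).

Definition flip_polytope : set pesp_point :=
  [set p : pesp_point | fractional_polytope p /\
     (forall gamma F, cycle_space gamma -> satisfies (flip_ineq gamma F) p)].

(* Four blocks of rows, in this order:
   Gamma x - T z <= 0,  - Gamma x + T z <= 0,  x <= u,  - x <= - l. *)
Definition pesp_row : finType :=
  (('I_(cyclomatic I) + 'I_(cyclomatic I)) + (darc I + darc I))%type.

Definition pesp_AC (i : pesp_row) (a : darc I) : R :=
  match i with
  | inl (inl k) => (Gamma k a)%:~R
  | inl (inr k) => - (Gamma k a)%:~R
  | inr (inl a') => (a' == a)%:R
  | inr (inr a') => - (a' == a)%:R
  end.

Definition pesp_AI (i : pesp_row) (k : 'I_(cyclomatic I)) : R :=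
  match i with
  | inl (inl k') => - (T%:R * (k' == k)%:R)
  | inl (inr k') => T%:R * (k' == k)%:R
  | inr _ => 0
  end.

Definition pesp_b (i : pesp_row) : R :=
  match i with
  | inl _ => 0
  | inr (inl a) => (u a)%:~R
  | inr (inr a) => - (l a)%:~R
  end.

Definition pesp_mip : mip R := Mip pesp_AC pesp_AI pesp_b.

Lemma pesp_mip_polyhedron : mip_polyhedron pesp_mip = fractional_polytope.
Proof.
have tk (p : pesp_point) (k : 'I_(cyclomatic I)) c :
    \sum_j c * (k == j)%:R * p.2 j = c * p.2 k :> R.
  rewrite (bigD1 k) //= eqxx mulr1 big1 ?addr0 // => j /negbTE;
     rewrite eq_sym => ->.
  by rewrite mulr0 mul0r.
have ta (p : pesp_point) (k : darc I) :
    \sum_j (k == j)%:R * p.1 j = p.1 k :> R.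
  rewrite (bigD1 k) //= eqxx mul1r big1 ?addr0 // => j /negbTE;
     rewrite eq_sym => ->.
  by rewrite mul0r.
apply/seteqP; split => p /=.
- move=> H; split.
    move=> k; have := H (inl (inl k)); have /= := H (inl (inr k)).
    under eq_bigr do rewrite mulNr.
    rewrite sumrN.
    under [X in _ -> _ + X <= _ -> _]eq_bigr do rewrite mulNr.
    rewrite sumrN !tk => h1 h2; apply/eqP; rewrite eq_le; apply/andP; split.
    by rewrite -subr_le0.
    by rewrite -subr_le0 addrC.
  move=> a; have /= := H (inr (inl a)); have /= := H (inr (inr a)).
  rewrite ta; under eq_bigr do rewrite mulNr; rewrite sumrN ta.
  rewrite big1 => [|? _]; last by rewrite mul0r.
  by rewrite !addr0 lerN2.
- case=> H1 H2 [[k|k]|[a|a]] /=.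
  + under [X in _ + X]eq_bigr do rewrite mulNr.
    by rewrite sumrN tk H1 subrr.
  + under eq_bigr do rewrite mulNr.
    by rewrite sumrN tk H1 addrC subrr.
  + rewrite ta big1 => [|? _]; last by rewrite mul0r.
    by rewrite addr0; case: (H2 a).
  + under eq_bigr do rewrite mulNr.
    rewrite sumrN ta big1 => [|? _]; last by rewrite mul0r.
    by rewrite addr0 lerN2; case: (H2 a).
Qed.

End Timetabling.

(* Main.v *)
(* A multiplier lambda annihilating A_C is, on the rows of the bounds, minus or
   plus gamma / T for a cycle gamma = sum_k c_k Gamma_k, and linear independence
   forces at most one bound row per arc, hence a set F; then the fractional part
   of lambda b is alpha / T, and the slacks of the cycle rows vanish on
   Gamma x = T z.  For the closures, put D and N for the parts of the flip
   inequality with coefficients T - alpha and alpha.  If c z is an integer, then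
   D - N = alpha mod T, which makes the flip inequality valid.  Conversely let c z
   have fractional part th in (0, 1).  Then x is the combination with weights
   1 - th and th of two points of the box at which gamma x is T floor(c z) and
   T (floor(c z) + 1) as soon as th (1 - th) T <= (1 - th) D + th N, where F
   selects the more restrictive bounds; this is implied by the flip inequality. *)

Require Import Defs.
From mathcomp Require Import all_boot all_order all_algebra.
From mathcomp Require Import classical_sets reals.
From mathcomp Require Import boolp convex interval_inference zify ring lra.

Set Implicit Arguments.
Unset Strict Implicit.
Unset Printing Implicit Defensive.

Import Order.TTheory GRing.Theory Num.Theory.

Local Open Scope ring_scope.

(** * Linear independence of families, fractional parts, elementary sums *)

(** [enum J] has no duplicates, so [index] and [nth] carry coefficients between elements of [J] and
    positions in the sequence. *)
Lemma free_familyP (K : fieldType) (vT : vectType K) (J : finType) (P : pred J)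
    (v : J -> vT) :
  free [seq v i | i <- enum J & P i] <->
  forall k : J -> K, \sum_(i | P i) k i *: v i = 0 -> forall i, P i -> k i = 0.
Proof.
rewrite -[free _]/(free (in_tuple [seq v i | i <- enum J & P i])).
set s := [seq i <- enum J | P i].
have us : uniq s by rewrite filter_uniq ?enum_uniq.
have ms i : (i \in s) = P i by rewrite mem_filter mem_enum andbT.
have sumE (F : J -> vT) : \sum_(i | P i) F i = \sum_(i <- s) F i.
  by rewrite big_filter big_enum_cond; apply: eq_bigl => i; rewrite inE.
split=> [/freeP fs k|fs].
  rewrite sumE => k0 i Pi.
  have lti : (index i s < size [seq v i | i <- s])%N.
    by rewrite size_map index_mem ms.
  have := fs (fun j => k (nth i s j)) _ (Ordinal lti).
  rewrite /= nth_index ?ms //; apply.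
  rewrite -[RHS]k0 (big_nth i) big_mkord -(size_map v s).
  apply: eq_bigr => j _; rewrite (nth_map i) // -(size_map v s).
  exact: ltn_ord.
apply/freeP => k k0 j.
have ltj : (j < size s)%N by rewrite -(size_map v s) ltn_ord.
(* A default for [nth]; the position [j] shows that one exists. *)
have /hasP[x0 _ _] : has predT s by rewrite has_predT (leq_ltn_trans _ ltj).
(* The value 0 serves the elements outside [s], whose index is the size of [s]. *)
pose k' i := if insub (index i s) is Some j then k j else 0.
have k'E i (lti : (i < size [seq v i | i <- s])%N) :
    k' (nth x0 s i) = k (Ordinal lti).
  rewrite /k' index_uniq //; last by rewrite -(size_map v s).
  by rewrite insubT.
have := fs k' _ (nth x0 s j); rewrite (k'E _ (ltn_ord j)) -ms mem_nth //.
have -> : Ordinal (ltn_ord j) = j by apply: val_inj.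
apply=> //; rewrite -[RHS]k0 sumE (big_nth x0) big_mkord -(size_map v s).
apply: eq_bigr => i _; rewrite (k'E _ (ltn_ord i)) (nth_map x0).
  by congr (k _ *: _); apply: val_inj.
by rewrite -(size_map v s) ltn_ord.
Qed.

Lemma fracpart_divz (R : realType) (n : int) (T : nat) : (0 < T)%N ->
  fracpart (n%:~R / T%:R : R) = (n %% T)%Z%:~R / T%:R.
Proof.
move=> T0; have T0' : (0 : R) < T%:R by rewrite ltr0n.
rewrite /fracpart.
have -> : Num.floor (n%:~R / T%:R : R) = (n %/ T)%Z.
  apply: floor_def; rewrite ler_pdivlMr // ltr_pdivrMr //.
  rewrite -!(intrM _ _ T%:Z) ler_int ltr_int.
  by rewrite lez_floor ?ltz_ceil // -?lt0n ?ltz_nat ?T0 // eqz_nat -lt0n.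
rewrite {1}(divz_eq n T) intrD intrM mulrDl -pmulrn mulfK ?gt_eqF //.
by rewrite addrAC subrr add0r.
Qed.

Lemma fracpart_eq0 (R : realType) (y : R) : (fracpart y == 0) = (y \is a Num.int).
Proof. by rewrite /fracpart subr_eq0 eq_sym intrEfloor. Qed.

Lemma max0_sub (R : realDomainType) (y : R) : Num.max y 0 - Num.max (- y) 0 = y.
Proof. by case: (lerP y 0); case: (lerP (- y) 0); lra. Qed.

Lemma sum_delta (R : pzSemiRingType) (J : finType) (c : R) (j : J) (f : J -> R) :
  \sum_i (c * (j == i)%:R) * f i = c * f j.
Proof.
rewrite (bigD1 j) //= eqxx mulr1 big1 ?addr0 // => i /negbTE.
by rewrite eq_sym => ->; rewrite mulr0 mul0r.
Qed.

Lemma sum_delta_r (R : pzSemiRingType) (J : finType) (f : J -> R) (j : J) :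
  \sum_i f i * (i == j)%:R = f j.
Proof.
rewrite (bigD1 j) //= eqxx mulr1 big1 ?addr0 // => i /negbTE ->.
by rewrite mulr0.
Qed.

(** * Two scalar inequalities *)

(** For [m >= 0] the first term suffices, as [D >= al]; for [m <= -1] the second does, as
    [N >= T - al]. *)
Lemma integer_flip_bound (R : realFieldType) (T D N al : R) (m : int) :
    0 < T -> 0 <= D -> 0 <= N -> 0 <= al -> al < T -> D - N = T * m%:~R + al ->
  al * (T - al) <= (T - al) * D + al * N.
Proof.
move=> T_gt0 D0 N0 al0 alT DN.
have TD : 0 <= (T - al) * D by rewrite mulr_ge0 // subr_ge0 ltW.
have aN : 0 <= al * N by rewrite mulr_ge0.
have [m0|m0] := lerP 0 m.
  have Tm : 0 <= T * m%:~R :> R by rewrite pmulr_rge0 // ler0z.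
  have : 0 <= (T - al) * (D - al) by apply: mulr_ge0; lra.
  by lra.
have Tm : T * m%:~R <= T * -1 :> R.
  by rewrite ler_pM2l // -[-1]/((-1)%:~R) ler_int; lia.
have : 0 <= al * (N - (T - al)) by apply: mulr_ge0; lra.
by lra.
Qed.

(** For [m >= 0] one has [D >= th * T], and for [m <= -2] one has [N >= (1 - th) * T], so a single
    term suffices. For [m = -1], eliminating [D] turns both the flip inequality and the claim into
    [N >= (T - al) * (1 - th)]. *)
Lemma split_interpolation_bound (R : realFieldType) (T D N al th : R) (m : int) :
    0 < T -> 0 <= D -> 0 <= N -> 0 <= al < T -> 0 < th < 1 ->
    D - N = T * (th + m%:~R) + al ->
    al * (T - al) <= (T - al) * D + al * N ->
  th * (1 - th) * T <= (1 - th) * D + th * N.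
Proof.
move=> T_gt0 D0 N0 /andP[al0 alT] /andP[th0 th1] DN fl.
have [m0|m0] := lerP 0 m.
  have m0' : 0 <= m%:~R :> R by rewrite ler0z.
  have : th * T <= D by nra.
  by nra.
have [m1|m1] := eqVneq m (-1).
  have DE : D = N + T * (th - 1) + al by rewrite -[D](subrK N) DN m1; ring.
  have NT : (T - al) * (1 - th) <= N.
    rewrite -(ler_pM2l T_gt0); move: fl; rewrite DE; lra.
  by rewrite DE; nra.
have m2 : m%:~R <= -2 :> R by rewrite -[-2]/((-2)%:~R) ler_int; lia.
have : (1 - th) * T <= N by nra.
by nra.
Qed.

(** * Flip inequalities through deviations from the bounds *)

Section FlipSplit.
Variables (R : realType) (I : pesp R).
Variable Gamma : 'I_(cyclomatic I) -> {ffun darc I -> int}.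

Local Notation T := (period I).
Local Notation pesp_point := (mixed_point R (darc I) 'I_(cyclomatic I)).
Local Notation row := (mip_row (pesp_mip Gamma)).
Local Notation pos_row k := (inl (inl k) : row).
Local Notation neg_row k := (inl (inr k) : row).
Local Notation upper_row a := (inr (inl a) : row).
Local Notation lower_row a := (inr (inr a) : row).

Implicit Types (F : {set darc I}) (g x : darc I -> R) (gamma : {ffun darc I -> int}).

Let T_gt0 : (0 : R) < T%:R.
Proof. by rewrite ltr0n; apply: leq_trans (period_ge2 I). Qed.

(* With [g = gamma], the terms of the flip inequality with coefficient T - alpha;
   with [g = - gamma], those with coefficient alpha. *)
Definition deviation g F x : R :=
  \sum_a (if a \in F then Num.max (- g a) 0 * ((upper I a)%:~R - x a)
          else Num.max (g a) 0 * (x a - (lower I a)%:~R)).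

(** The bound at which the term of [a] vanishes in both deviations. *)
Definition active_bound F (a : darc I) : int :=
  if a \in F then upper I a else lower I a.

(** The residue [alpha] before reduction modulo [T]. *)
Definition active_offset gamma F : int := - \sum_a gamma a * active_bound F a.

Definition in_box x :=
  forall a, (lower I a)%:~R <= x a /\ x a <= (upper I a)%:~R.

Lemma deviation_ge0 g F x : in_box x -> 0 <= deviation g F x.
Proof.
move=> bx; apply: sumr_ge0 => a _; have [lx xu] := bx a.
by case: ifP => _; rewrite mulr_ge0 ?subr_ge0 // le_max lexx orbT.
Qed.

(** Positive and negative parts recombine into [g]; on [F] the two sign changes cancel. *)
Lemma deviation_sub g F x :
  deviation g F x - deviation (fun a => - g a) F x =
  \sum_a g a * (x a - (active_bound F a)%:~R).
Proof.
rewrite -sumrB; apply: eq_bigr => a _; rewrite /active_bound.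
case: ifP => _; rewrite -mulrBl; last by rewrite max0_sub.
by rewrite (max0_sub (- g a)) mulNr -mulrN opprB.
Qed.

Lemma deviation_scale c g F x : 0 <= c ->
  deviation (fun a => c * g a) F x = c * deviation g F x.
Proof.
move=> c0; rewrite mulr_sumr; apply: eq_bigr => a _.
by case: ifP => _; rewrite mulrA maxr_pMr // mulr0 // mulrN.
Qed.

Lemma deviation_conv g F x y (t : R) :
  deviation g F (fun a => t * x a + (1 - t) * y a) =
  t * deviation g F x + (1 - t) * deviation g F y.
Proof.
rewrite /deviation !mulr_sumr -big_split; apply: eq_bigr => a _ /=.
by case: ifP => _; ring.
Qed.

Lemma flip_alphaE gamma F :
  flip_alpha gamma F = (active_offset gamma F %% T)%Z.
Proof.
congr (_ %% _)%Z; rewrite /active_offset [in RHS](bigID (mem F)) /= opprD [RHS]addrC.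
congr (_ - _).
  rewrite (eq_bigl (fun a => a \notin F)) => [|a]; last by rewrite inE.
  by congr (- _); apply: eq_bigr => a; rewrite /active_bound => /negbTE ->.
by apply: eq_bigr => a aF; rewrite /active_bound aF.
Qed.

Lemma flip_alpha_ge0 gamma F : 0 <= (flip_alpha gamma F)%:~R :> R.
Proof.
rewrite flip_alphaE ler0z modz_ge0 // eqz_nat -lt0n.
exact: leq_trans (period_ge2 I).
Qed.

Lemma flip_alpha_lt gamma F : (flip_alpha gamma F)%:~R < T%:R :> R.
Proof.
rewrite flip_alphaE -[T%:R]/(T%:Z%:~R) ltr_int ltz_pmod // ltz_nat.
exact: leq_trans (period_ge2 I).
Qed.

Lemma sum_pos_part (P : pred (darc I)) g f :
  \sum_(a | P a && (0 < g a)) g a * f a =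
  \sum_(a | P a) Num.max (g a) 0 * f a :> R.
Proof.
rewrite big_mkcondr; apply: eq_bigr => a _.
by case: (ltrP 0 (g a)) => // _; rewrite mul0r.
Qed.

Lemma deviationE g F x :
  deviation g F x =
  \sum_(a in ~: F | 0 < g a) g a * (x a - (lower I a)%:~R)
  + \sum_(a in F | g a < 0) - g a * ((upper I a)%:~R - x a).
Proof.
under [X in _ + X]eq_bigl do rewrite -oppr_gt0.
rewrite (sum_pos_part _ (fun a => - g a)) sum_pos_part /deviation.
rewrite [LHS](bigID (mem F)) [LHS]addrC /=; congr (_ + _).
  by apply: eq_big => [a|a /negbTE ->] //; rewrite inE.
by apply: eq_bigr => a ->.
Qed.

Lemma flip_lhsE gamma F (p : pesp_point) :
  let alpha : R := (flip_alpha gamma F)%:~R in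
  let g a : R := (gamma a)%:~R in
  ineq_lhs (flip_ineq gamma F) p =
  (T%:R - alpha) * deviation g F p.1
  + alpha * deviation (fun a => - g a) F p.1.
Proof.
move=> alpha g.
have pos (D : {set darc I}) f :
    \sum_(a in D | 0 < gamma a) f a = \sum_(a in D | 0 < g a) f a :> R.
  by apply: eq_bigl => a; rewrite ltr0z.
have neg (D : {set darc I}) f :
    \sum_(a in D | gamma a < 0) f a = \sum_(a in D | g a < 0) f a :> R.
  by apply: eq_bigl => a; rewrite ltrz0.
rewrite [LHS]/= -/alpha !pos !neg !deviationE.
under [X in _ = _ + _ * (X + _)]eq_bigl do rewrite oppr_gt0.
under [X in _ = _ + _ * (_ + X)]eq_bigl do rewrite oppr_lt0.
under [X in _ = _ + _ * (_ + X)]eq_bigr do rewrite opprK.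
by ring.
Qed.

(** * Row sums and slacks of the formulation *)

Lemma sum_row (V : nmodType) (f : row -> V) :
  \sum_i f i = \sum_k f (pos_row k) + \sum_k f (neg_row k)
               + (\sum_a f (upper_row a) + \sum_a f (lower_row a)).
Proof. by rewrite big_sumType !big_sumType. Qed.

Lemma slack_upper (p : pesp_point) a :
  mip_slack (pesp_mip Gamma) p (upper_row a) = (upper I a)%:~R - p.1 a.
Proof.
rewrite /mip_slack /=; under eq_bigr do rewrite -[(_ == _)%:R]mul1r.
by rewrite sum_delta mul1r [X in _ - X]big1 ?subr0 // => k _; rewrite mul0r.
Qed.

Lemma slack_lower (p : pesp_point) a :
  mip_slack (pesp_mip Gamma) p (lower_row a) = p.1 a - (lower I a)%:~R.
Proof.
rewrite /mip_slack /=; under eq_bigr do rewrite -mulN1r.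
rewrite sum_delta mulN1r [X in _ - X]big1 => [|k _]; last by rewrite mul0r.
by rewrite subr0 opprK addrC.
Qed.

Lemma slack_cycle (p : pesp_point) i : cycle_periodic Gamma p ->
  mip_slack (pesp_mip Gamma) p (inl i : row) = 0.
Proof.
move=> cp; rewrite /mip_slack; case: i => k /=.
  under [X in _ - X]eq_bigr do rewrite -mulNr.
  by rewrite sum_delta cp sub0r mulNr subrr.
under eq_bigr do rewrite mulNr.
by rewrite sum_delta sumrN cp opprK add0r subrr.
Qed.

(** On [Gamma x = T z] the cycle rows have zero slack, and each arc contributes through the bound
    row that [F] selects. A general [mu] covers both [lambda] and [- lambda]. *)
Lemma sum_slack (mu : row -> R) g F (p : pesp_point) :
    cycle_periodic Gamma p ->
    (forall a, mu (upper_row a) = if a \in F then - g a else 0) ->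
    (forall a, mu (lower_row a) = if a \in F then 0 else g a) ->
  \sum_i Num.max (mu i) 0 * mip_slack (pesp_mip Gamma) p i = deviation g F p.1.
Proof.
move=> cp muu mul; rewrite sum_row.
rewrite [X in X + _ + _]big1 => [|k _]; last by rewrite slack_cycle ?mulr0.
rewrite [X in _ + X + _]big1 => [|k _]; last by rewrite slack_cycle ?mulr0.
rewrite !add0r -big_split; apply: eq_bigr => a _ /=.
rewrite slack_upper slack_lower muu mul.
by case: ifP => _; rewrite maxxx mul0r ?addr0 ?add0r.
Qed.

(** * Split inequalities with bound entries given by an integer vector and an arc set *)

Section FlipMultiplier.
Variables (lambda : {ffun row -> R}) (gamma : {ffun darc I -> int}).
Variable F : {set darc I}.
Hypothesis lambda_upper : forall a,
  lambda (upper_row a) = if a \in F then - (gamma a)%:~R / T%:R else 0.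
Hypothesis lambda_lower : forall a,
  lambda (lower_row a) = if a \in F then 0 else (gamma a)%:~R / T%:R.

Lemma split_rhs_flip :
  split_rhs (pesp_mip Gamma) lambda = (active_offset gamma F)%:~R / T%:R.
Proof.
rewrite /split_rhs sum_row /=.
rewrite [X in X + _ + _]big1 => [|k _]; last by rewrite mulr0.
rewrite [X in _ + X + _]big1 => [|k _]; last by rewrite mulr0.
rewrite !add0r -big_split /active_offset -sumrN rmorph_sum mulr_suml /=.
apply: eq_bigr => a _; rewrite lambda_upper lambda_lower /active_bound.
by case: ifP => _; rewrite ?(mul0r, addr0, add0r) rmorphN /= intrM; ring.
Qed.

Lemma fracpart_flip : fracpart (split_rhs (pesp_mip Gamma) lambda) =
  (flip_alpha gamma F)%:~R / T%:R.
Proof.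
rewrite split_rhs_flip fracpart_divz ?flip_alphaE //.
exact: leq_trans (period_ge2 I).
Qed.

Lemma split_rhs_flip_int :
  (split_rhs (pesp_mip Gamma) lambda \is a Num.int) = (flip_alpha gamma F == 0).
Proof.
by rewrite -fracpart_eq0 fracpart_flip mulf_eq0 invr_eq0 (gt_eqF T_gt0) orbF
  intr_eq0.
Qed.

(** The positive and negative parts of [lambda] yield [D / T] over [alpha / T] and [N / T] over
    [1 - alpha / T], that is [D / alpha + N / (T - alpha)]; the factor clears the denominators. *)
Lemma flip_split_multiple (p : pesp_point) :
  flip_alpha gamma F <> 0 -> cycle_periodic Gamma p ->
  let alpha : R := (flip_alpha gamma F)%:~R in
  ineq_lhs (flip_ineq gamma F) p =
  alpha * (T%:R - alpha) * ineq_lhs (split_ineq (pesp_mip Gamma) lambda) p.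
Proof.
move=> /eqP a0 cp alpha; rewrite flip_lhsE /= fracpart_flip -/alpha.
have {a0} a0 : alpha != 0 by rewrite intr_eq0.
have aT : T%:R - alpha != 0 by rewrite subr_eq0 gt_eqF // flip_alpha_lt.
have T0 : T%:R != 0 :> R by rewrite gt_eqF.
set g : darc I -> R := fun a => (gamma a)%:~R.
have iT : 0 <= T%:R^-1 :> R by rewrite invr_ge0 ltW.
rewrite (@sum_slack _ (fun a => T%:R^-1 * g a) F) //; last 2 first.
- by move=> a; rewrite lambda_upper mulNr mulrC.
- by move=> a; rewrite lambda_lower mulrC.
rewrite (@sum_slack (fun i => - lambda i) (fun a => T%:R^-1 * - g a) F) //;
  last 2 first.
- by move=> a; rewrite lambda_upper /g; case: ifP => _; rewrite ?oppr0 // mulrN mulNr mulrC.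
- by move=> a; rewrite lambda_lower /g; case: ifP => _; rewrite ?oppr0 // mulrN mulrC.
rewrite !deviation_scale // /g.
by field; rewrite a0 aT T0.
Qed.

End FlipMultiplier.

(** * Correspondence between multipliers and pairs of a cycle and an arc set *)

Hypothesis Gamma_basis : integral_cycle_basis Gamma.

Lemma basis_combination gamma : cycle_space gamma ->
  exists c : {ffun 'I_(cyclomatic I) -> int},
    forall a, gamma a = \sum_k c k * Gamma k a.
Proof. by case: Gamma_basis => _ h /h[c [hc _]]; exists c. Qed.

Lemma combination_cycle (c : 'I_(cyclomatic I) -> int) :
  cycle_space [ffun a => \sum_k c k * Gamma k a].
Proof.
move=> i; under eq_bigr do rewrite ffunE; under [RHS]eq_bigr do rewrite ffunE.
rewrite exchange_big [RHS]exchange_big; apply: eq_bigr => k _ /=.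
by rewrite -!mulr_sumr; case: Gamma_basis => /(_ k)[-> _].
Qed.

(** Entries on the rows [Gamma x - T z <= 0] may have any sign; leaving the opposite rows at 0 keeps
    the support independent. *)
Definition flip_multiplier (c : 'I_(cyclomatic I) -> int) gamma F : {ffun row -> R} :=
  [ffun i => match i : pesp_row I with
   | inl (inl k) => (c k)%:~R / T%:R
   | inl (inr k) => 0
   | inr (inl a) => if a \in F then - (gamma a)%:~R / T%:R else 0
   | inr (inr a) => if a \in F then 0 else (gamma a)%:~R / T%:R
   end].

Lemma sum_AC (f : row -> R) a :
  \sum_i f i * mip_AC i a =
  \sum_k (f (pos_row k) - f (neg_row k)) * (Gamma k a)%:~R
  + (f (upper_row a) - f (lower_row a)).
Proof.
rewrite sum_row -big_split /=; congr (_ + _).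
  by apply: eq_bigr => k _; rewrite mulrN mulrBl.
rewrite sum_delta_r; congr (_ + _).
by under eq_bigr do rewrite mulrN; rewrite sumrN sum_delta_r.
Qed.

Lemma sum_AI (f : row -> R) k :
  \sum_i f i * mip_AI i k = T%:R * (f (neg_row k) - f (pos_row k)).
Proof.
rewrite sum_row /= [X in _ + (X + _)]big1 => [|a _]; last by rewrite mulr0.
rewrite [X in _ + (_ + X)]big1 => [|a _]; last by rewrite mulr0.
under eq_bigr do rewrite mulrN mulrA.
under [X in _ + X + _]eq_bigr do rewrite mulrA.
by rewrite sumrN !sum_delta_r; ring.
Qed.

(** Setting the coefficients outside [P] to 0 makes [sum_AC] and [sum_AI] applicable, which run over
    all rows. *)
Lemma rowvec_eq0 (f : row -> R) (P : pred row) :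
  \sum_(i | P i) f i *: mip_rowvec (pesp_mip Gamma) i = 0 <->
  let f' i := if P i then f i else 0 in
  (forall a, \sum_i f' i * mip_AC i a = 0) /\
  (forall k, \sum_i f' i * mip_AI i k = 0).
Proof.
have fst_sum a : (\sum_(i | P i) f i *: mip_rowvec (pesp_mip Gamma) i).1 a =
    \sum_i (if P i then f i else 0) * mip_AC i a.
  rewrite raddf_sum sum_ffunE big_mkcond; apply: eq_bigr => i _ /=.
  by case: ifP => _; rewrite ?mul0r // !ffunE.
have snd_sum k : (\sum_(i | P i) f i *: mip_rowvec (pesp_mip Gamma) i).2 k =
    \sum_i (if P i then f i else 0) * mip_AI i k.
  rewrite raddf_sum sum_ffunE big_mkcond; apply: eq_bigr => i _ /=.
  by case: ifP => _; rewrite ?mul0r // !ffunE.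
split=> [s0|[h1 h2]].
  by split=> j; rewrite -?fst_sum -?snd_sum s0 ffunE.
rewrite [LHS]surjective_pairing; congr pair; apply/ffunP => j;
  by rewrite ?fst_sum ?snd_sum ?h1 ?h2 ffunE.
Qed.

(** For independence, the [z]-columns first kill the coefficients of the cycle rows, as [T] is
    non-zero and only one row of each opposite pair can be in the support. The [x]-columns then
    equate the two bound coefficients of each arc, one of which lies outside the support. *)
Lemma flip_multiplierP c gamma F :
    (forall a, gamma a = \sum_k c k * Gamma k a) ->
    flip_alpha gamma F <> 0 ->
  split_multiplier (pesp_mip Gamma) (flip_multiplier c gamma F).
Proof.
move=> gE a0; have T0 : T%:R != 0 :> R by rewrite gt_eqF.
split=> [a|k||].
- rewrite sum_AC !ffunE /=.
  have -> : \sum_k ((flip_multiplier c gamma F (pos_row k)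
      - flip_multiplier c gamma F (neg_row k)) * (Gamma k a)%:~R) =
      (gamma a)%:~R / T%:R.
    rewrite gE rmorph_sum mulr_suml; apply: eq_bigr => k _ /=.
    by rewrite !ffunE subr0 intrM mulrAC.
  by case: ifP => _; ring.
- rewrite sum_AI !ffunE /= sub0r mulrN mulrCA divff // mulr1.
  by rewrite rpredN intr_int.
- rewrite (@split_rhs_flip_int _ gamma F); first exact/eqP.
  + by move=> a; rewrite ffunE.
  + by move=> a; rewrite ffunE.
apply/free_familyP => f f0.
pose f' i := if flip_multiplier c gamma F i != 0 then f i else 0.
have [h1 h2] : (forall a, \sum_i f' i * mip_AC i a = 0) /\
    (forall k, \sum_i f' i * mip_AI i k = 0) by exact/rowvec_eq0.
suff f'0 i : f' i = 0 by move=> i Pi; have := f'0 i; rewrite /f' Pi.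
have neg0 k : f' (neg_row k) = 0 by rewrite /f' ffunE /= eqxx.
have pos0 k : f' (pos_row k) = 0.
  have /eqP := h2 k; rewrite sum_AI neg0 sub0r mulrN oppr_eq0 mulf_eq0.
  by rewrite (negbTE T0) => /eqP.
have ul a : f' (upper_row a) = f' (lower_row a).
  have := h1 a; rewrite sum_AC big1 ?add0r => [/subr0_eq //|k _].
  by rewrite pos0 neg0 subrr mul0r.
have ul0 a : f' (upper_row a) = 0 /\ f' (lower_row a) = 0.
  case aF : (a \in F).
    have l0 : f' (lower_row a) = 0 by rewrite /f' ffunE aF eqxx.
    by rewrite ul.
  have u0 : f' (upper_row a) = 0 by rewrite /f' ffunE aF eqxx.
  by rewrite -ul.
by case: i => [[k|k]|[a|a]]; rewrite ?pos0 ?neg0 //; case: (ul0 a).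
Qed.

(** The two bound rows of an arc are opposite vectors, so an independent support cannot contain
    both. *)
Lemma split_multiplier_bounds lambda a :
  split_multiplier (pesp_mip Gamma) lambda ->
  lambda (upper_row a) != 0 -> lambda (lower_row a) = 0.
Proof.
case=> _ _ _ /free_familyP fr u0; apply/eqP/negPn/negP => l0.
pose f i : R := (i == upper_row a)%:R + (i == lower_row a)%:R.
have : f (upper_row a) = 0.
  apply: fr => //; apply/rowvec_eq0 => f'.
  have f'E i : f' i = f i.
    rewrite /f' /f; case: (i =P upper_row a) => [->|_]; first by rewrite u0.
    by case: (i =P lower_row a) => [->|_]; rewrite ?l0 // addr0 if_same.
  split=> [b|k]; rewrite ?sum_AC ?sum_AI !f'E /f /=.
    rewrite big1 ?add0r => [|k _]; last by rewrite !f'E /f /= subrr mul0r.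
    rewrite !(inj_eq (@inr_inj _ _)) !(inj_eq (@inl_inj _ _)) /=.
    by rewrite addr0 subrr.
  by rewrite subrr mulr0.
by rewrite /f eqxx /= addr0 => /eqP; rewrite oner_eq0.
Qed.

Lemma split_multiplier_flip lambda :
  split_multiplier (pesp_mip Gamma) lambda ->
  exists (gamma : {ffun darc I -> int}) F,
    [/\ cycle_space gamma,
        (forall a, lambda (upper_row a) =
           if a \in F then - (gamma a)%:~R / T%:R else 0) &
        (forall a, lambda (lower_row a) =
           if a \in F then 0 else (gamma a)%:~R / T%:R)].
Proof.
move=> ml; have [AC0 AIint _ _] := ml.
(* Up to sign these are the entries of [lambda] applied to [A_I], hence integers, and the floor
   changes nothing. *)
pose c k := Num.floor (T%:R * (lambda (pos_row k) - lambda (neg_row k))).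
have cE k : (c k)%:~R = T%:R * (lambda (pos_row k) - lambda (neg_row k)).
  by apply: floorK; rewrite -rpredN -mulrN opprB -sum_AI.
pose gamma := [ffun a => \sum_k c k * Gamma k a].
(* That [lambda] annihilates [A_C] expresses the cycle part through the two bound entries of the
   arc. *)
have gammaE a : (gamma a)%:~R / T%:R =
    lambda (lower_row a) - lambda (upper_row a).
  have T0 : T%:R != 0 :> R by rewrite gt_eqF.
  have := AC0 a; rewrite sum_AC => /eqP; rewrite addr_eq0 opprB => /eqP <-.
  rewrite ffunE rmorph_sum mulr_suml; apply: eq_bigr => k _ /=.
  by rewrite intrM cE; field.
(* [F] collects the arcs whose upper row is in the support; on these the lower entry is 0. *)
exists gamma, [set a | lambda (upper_row a) != 0]; split.
- exact: combination_cycle.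
- move=> a; rewrite inE mulNr gammaE; case: eqP => //= /eqP /split_multiplier_bounds.
  by move=> ->; rewrite // sub0r opprK.
- move=> a; rewrite inE gammaE; case: eqP => /= [->|/eqP u0]; first by rewrite subr0.
  exact: split_multiplier_bounds.
Qed.

(** * Flip inequalities hold on the split closure *)

Lemma cycle_dot (c : 'I_(cyclomatic I) -> int) gamma (p : pesp_point) :
    (forall a, gamma a = \sum_k c k * Gamma k a) -> cycle_periodic Gamma p ->
  \sum_a (gamma a)%:~R * p.1 a = T%:R * \sum_k (c k)%:~R * p.2 k.
Proof.
move=> gE cp; rewrite mulr_sumr.
under [RHS]eq_bigr do rewrite mulrCA -cp mulr_sumr.
rewrite exchange_big; apply: eq_bigr => a _; rewrite gE rmorph_sum mulr_suml.
by apply: eq_bigr => k _; rewrite /= intrM mulrA.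
Qed.

(** [D - N] is [gamma x] plus the offset; [gamma x] is [T] times [c z], and [q] is the quotient of
    the offset by [T]. *)
Lemma deviation_mod (c : 'I_(cyclomatic I) -> int) gamma F (p : pesp_point) :
    (forall a, gamma a = \sum_k c k * Gamma k a) -> cycle_periodic Gamma p ->
  exists q : int,
    deviation (fun a => (gamma a)%:~R) F p.1
      - deviation (fun a => - (gamma a)%:~R) F p.1 =
    T%:R * (\sum_k (c k)%:~R * p.2 k + q%:~R) + (flip_alpha gamma F)%:~R.
Proof.
move=> gE cp; exists (active_offset gamma F %/ T)%Z.
rewrite deviation_sub mulrDr -addrA -(cycle_dot gE cp) flip_alphaE.
have -> : T%:R * (active_offset gamma F %/ T)%Z%:~R
    + (active_offset gamma F %% T)%Z%:~R = (active_offset gamma F)%:~R :> R.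
  by rewrite [in RHS](divz_eq (active_offset gamma F) T) [RHS]intrD intrM mulrC.
rewrite /active_offset -sumrN rmorph_sum -big_split; apply: eq_bigr => a _ /=.
by rewrite rmorphN /= intrM mulrBr.
Qed.

Lemma flip_valid (c : 'I_(cyclomatic I) -> int) gamma F (p : pesp_point) :
    (forall a, gamma a = \sum_k c k * Gamma k a) ->
    fractional_polytope Gamma p ->
    \sum_k (c k)%:~R * p.2 k \is a Num.int ->
  satisfies (flip_ineq gamma F) p.
Proof.
move=> gE [cp bx] /intrP[s sE]; rewrite /satisfies flip_lhsE.
have [q] := deviation_mod F gE cp; rewrite sE -intrD.
have := flip_alpha_ge0 gamma F; have := flip_alpha_lt gamma F.
have := deviation_ge0 (fun a => (gamma a)%:~R) F bx.
have := deviation_ge0 (fun a => - (gamma a)%:~R) F bx.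
rewrite /=; move: (s + q) => m N0 D0 alT al0.
exact: integer_flip_bound T_gt0 _ _ _ _.
Qed.

Lemma conv_fst (p q : pesp_point) (t : {i01 R}) a :
  (conv t (p : convex_lmodType _) q).1 a = t%:num * p.1 a + (1 - t%:num) * q.1 a.
Proof. by rewrite /conv /= !ffunE. Qed.

Lemma conv_snd (p q : pesp_point) (t : {i01 R}) k :
  (conv t (p : convex_lmodType _) q).2 k = t%:num * p.2 k + (1 - t%:num) * q.2 k.
Proof. by rewrite /conv /= !ffunE. Qed.

Definition flip_region gamma F : set pesp_point :=
  [set p | fractional_polytope Gamma p /\ satisfies (flip_ineq gamma F) p]%classic.

(** For fixed [F] both deviations are affine in [x], so the region is cut out by linear equations
    and inequalities. *)
Lemma convex_flip_region gamma F : convex_set (flip_region gamma F).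
Proof.
move=> p q t; rewrite !inE /= => -[[cp bp] fp] [[cq bq] fq].
have t0 : 0 <= t%:num :> R by [].
have t1 : 0 <= 1 - t%:num :> R by rewrite subr_ge0.
split; first split.
- move=> k; under eq_bigr do rewrite conv_fst mulrDr !(mulrCA _%:~R).
  by rewrite conv_snd big_split -!mulr_sumr /= cp cq; ring.
- by move=> a; rewrite conv_fst; have := bp a; have := bq a; split; nra.
have devE g : deviation g F (conv t (p : convex_lmodType _) q).1 =
    t%:num * deviation g F p.1 + (1 - t%:num) * deviation g F q.1.
  rewrite -deviation_conv; apply: eq_bigr => a _.
  by rewrite conv_fst.
move: fp fq; rewrite /satisfies !flip_lhsE !devE /=.
by move=> fp fq; nra.
Qed.

(** With [beta] the coordinates [c] of [gamma] in the basis, the flip region is convex and contains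
    the points of the polytope with [c z] integral, hence also their hull. *)
Lemma split_sub_flip :
  (split_closure (pesp_mip Gamma) `<=` flip_polytope Gamma)%classic.
Proof.
move=> p sp.
have key gamma F : cycle_space gamma -> flip_region gamma F p.
  move=> /basis_combination[c gE]; have := sp c Logic.I; apply: smallest_sub.
    exact: convex_flip_region.
  by move=> q []; rewrite pesp_mip_polyhedron => Pq /(flip_valid F gE Pq).
split; last by move=> gamma F cyc; case: (key gamma F cyc).
(* The zero cycle always exists and yields membership in the polytope. *)
have [] // := key [ffun=> 0] finset.set0.
by move=> i; rewrite !big1 // => a _; rewrite ffunE.
Qed.

(** * Decomposing points of the flip polytope *)

(** As [T] is non-zero, [Gamma x = T z] determines [z] from [x], so convex combinations can be built
    in the box alone. *)
Definition pesp_point_of x : pesp_point :=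
  ([ffun a => x a], [ffun k => (\sum_a (Gamma k a)%:~R * x a) / T%:R]).

Lemma pesp_point_ofP x : in_box x -> fractional_polytope Gamma (pesp_point_of x).
Proof.
move=> bx; split=> [k|a]; last by rewrite ffunE.
rewrite ffunE mulrC divfK ?gt_eqF //.
by apply: eq_bigr => a _; rewrite ffunE.
Qed.

Lemma pesp_point_of_dot (c : 'I_(cyclomatic I) -> int) gamma x :
    (forall a, gamma a = \sum_k c k * Gamma k a) -> in_box x ->
  \sum_k (c k)%:~R * (pesp_point_of x).2 k = (\sum_a (gamma a)%:~R * x a) / T%:R.
Proof.
move=> gE bx; have [cp _] := pesp_point_ofP bx.
have -> : \sum_a (gamma a)%:~R * x a = \sum_a (gamma a)%:~R * (pesp_point_of x).1 a.
  by apply: eq_bigr => a _; rewrite ffunE.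
by rewrite (cycle_dot gE cp) mulrAC divff ?mul1r ?gt_eqF.
Qed.

Lemma pesp_point_of_fst (p : pesp_point) :
  cycle_periodic Gamma p -> p = pesp_point_of p.1.
Proof.
move=> cp; rewrite [LHS]surjective_pairing; congr pair; apply/ffunP => j.
  by rewrite ffunE.
by rewrite ffunE cp mulrAC divff ?mul1r ?gt_eqF.
Qed.

Lemma pesp_point_of_conv x y (t : {i01 R}) :
  pesp_point_of (fun a => t%:num * x a + (1 - t%:num) * y a) =
  conv t (pesp_point_of x : convex_lmodType _) (pesp_point_of y).
Proof.
rewrite [LHS]surjective_pairing [RHS]surjective_pairing; congr pair.
  by apply/ffunP => a; rewrite conv_fst !ffunE.
apply/ffunP => k; rewrite conv_snd !ffunE !mulrA -mulrDl; congr (_ / _).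
rewrite !mulr_sumr -big_split; apply: eq_bigr => a _ /=.
by ring.
Qed.

(* [e] maximises gamma e subject to x + e / th and x - e / (1 - th) lying in the
   box; [F] records which of the two constraints on each coordinate is tight. *)
Lemma extremal_direction gamma x (th : R) : in_box x -> 0 < th < 1 ->
  exists F (e : darc I -> R),
    \sum_a (gamma a)%:~R * e a =
      (1 - th) * deviation (fun a => (gamma a)%:~R) F x
      + th * deviation (fun a => - (gamma a)%:~R) F x /\
    forall a,
      [/\ - (th * (x a - (lower I a)%:~R)) <= e a,
          e a <= th * ((upper I a)%:~R - x a),
          - ((1 - th) * ((upper I a)%:~R - x a)) <= e a &
          e a <= (1 - th) * (x a - (lower I a)%:~R)].
Proof.
move=> bx /andP[th0 th1].
pose dl a := x a - (lower I a)%:~R; pose du a := (upper I a)%:~R - x a.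
pose F := [set a | if 0 < gamma a then th * du a <= (1 - th) * dl a
                   else (1 - th) * du a <= th * dl a].
pose e a := if 0 < gamma a
  then (if a \in F then th * du a else (1 - th) * dl a)
  else (if a \in F then - ((1 - th) * du a) else - (th * dl a)).
exists F, e; split.
  rewrite /deviation !mulr_sumr -big_split; apply: eq_bigr => a _ /=.
  rewrite opprK /e -/(dl a) -/(du a).
  have [g0|g0] := ltrP 0 (gamma a).
    have g0' : 0 < (gamma a)%:~R :> R by rewrite ltr0z.
    rewrite (max_l (ltW g0')) (max_r (_ : - _ <= 0)) ?oppr_le0 ?ltW //.
    by case: ifP => _; ring.
  have g0' : (gamma a)%:~R <= 0 :> R by rewrite lerz0.
  rewrite (max_r g0') (max_l (_ : 0 <= - _)) ?oppr_ge0 //.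
  by case: ifP => _; ring.
move=> a; have [la ua] := bx a.
have l0 : 0 <= dl a by rewrite subr_ge0.
have u0 : 0 <= du a by rewrite subr_ge0.
have tl0 : 0 <= th * dl a by rewrite mulr_ge0 // ltW.
have tu0 : 0 <= th * du a by rewrite mulr_ge0 // ltW.
have tl1 : 0 <= (1 - th) * dl a by rewrite mulr_ge0 // subr_ge0 ltW.
have tu1 : 0 <= (1 - th) * du a by rewrite mulr_ge0 // subr_ge0 ltW.
rewrite -/(dl a) -/(du a) /e inE.
by have [_|_] := ltrP 0 (gamma a); case: ifP => [?|/negbT];
  rewrite -?ltNge; split; lra.
Qed.

Lemma flip_sub_split :
  (flip_polytope Gamma `<=` split_closure (pesp_mip Gamma))%classic.
Proof.
move=> p [[cp bx] flips] c _.
pose gamma := [ffun a => \sum_k c k * Gamma k a].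
have gE a : gamma a = \sum_k c k * Gamma k a by rewrite ffunE.
set s := \sum_k (c k)%:~R * p.2 k : R.
have [sint|sint] := boolP (s \is a Num.int).
  by apply: sub_gen_smallest; split => //; rewrite pesp_mip_polyhedron.
pose th := fracpart s.
have sE : s = (Num.floor s)%:~R + th by rewrite /th /fracpart addrC subrK.
have th01 : 0 < th < 1.
  rewrite lt_neqAle eq_sym fracpart_eq0 sint /= /th /fracpart subr_ge0 floor_le.
  by have := floorD1_gt s; rewrite intrD => ?; rewrite ltrBlDl.
have /andP[th0 th1] := th01.
have [F [e [eE eb]]] := extremal_direction gamma bx th01.
set M := \sum_a _ in eE.
have [q] := deviation_mod F gE cp; rewrite -/s => dE.
(* The flip inequality for the [F] of the extremal direction bounds its gain [M] from below. *)
have MT : th * (1 - th) * T%:R <= M.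
  rewrite eE; apply: (@split_interpolation_bound _ _ _ _ (flip_alpha gamma F)%:~R _
    (Num.floor s + q)).
  - exact: T_gt0.
  - exact: deviation_ge0.
  - exact: deviation_ge0.
  - by rewrite flip_alpha_ge0 flip_alpha_lt.
  - exact: th01.
  - by rewrite dE {1}sE intrD; ring.
  - have := flips gamma F (combination_cycle c).
    by rewrite /satisfies flip_lhsE.
have num0 : 0 < th * (1 - th) * T%:R by rewrite mulr_gt0 // mulr_gt0 // subr_gt0.
have M0 : 0 < M by apply: lt_le_trans MT.
(* Moving by [t * e / th] now raises [gamma x] by [(1 - th) * T], and moving by [- t * e / (1 - th)]
   lowers it by [th * T]: these reach the two multiples of [T] around [T * s]. *)
pose t := th * (1 - th) * T%:R / M.
have t0 : 0 <= t by apply: divr_ge0; exact: ltW.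
have t1 : t <= 1 by rewrite ler_pdivrMr // mul1r.
have tM : t * M = th * (1 - th) * T%:R by rewrite /t divfK ?gt_eqF.
have th0' : th != 0 by rewrite gt_eqF.
have th1' : 1 - th != 0 by rewrite subr_eq0 gt_eqF.
have T0 : T%:R != 0 :> R by rewrite gt_eqF.
pose xup a := p.1 a + t * (e a / th).
pose xdn a := p.1 a - t * (e a / (1 - th)).
(* The interval contains 0, so scaling by [t] in [[0, 1]] does not leave it. *)
have scale_in (y lo hi : R) : lo <= 0 -> 0 <= hi -> lo <= y -> y <= hi ->
    lo <= t * y /\ t * y <= hi.
  by move=> *; split; nra.
have bup : in_box xup.
  move=> a; have [e1 e2 e3 e4] := eb a; have [la ua] := bx a.
  have [] := scale_in (e a / th) ((lower I a)%:~R - p.1 a)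
    ((upper I a)%:~R - p.1 a).
  - by rewrite subr_le0.
  - by rewrite subr_ge0.
  - by rewrite ler_pdivlMr // mulrC; lra.
  - by rewrite ler_pdivrMr // mulrC.
  by rewrite /xup; lra.
have bdn : in_box xdn.
  move=> a; have [e1 e2 e3 e4] := eb a; have [la ua] := bx a.
  have [] := scale_in (e a / (1 - th)) (p.1 a - (upper I a)%:~R)
    (p.1 a - (lower I a)%:~R).
  - by rewrite subr_le0.
  - by rewrite subr_ge0.
  - by rewrite ler_pdivlMr ?subr_gt0 // mulrC; lra.
  - by rewrite ler_pdivrMr ?subr_gt0 // mulrC.
  by rewrite /xdn; lra.
have gx : \sum_a (gamma a)%:~R * p.1 a = T%:R * s by exact: cycle_dot.
have dup : \sum_a (gamma a)%:~R * xup a = T%:R * (Num.floor s + 1)%:~R.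
  have -> : \sum_a (gamma a)%:~R * xup a = T%:R * s + t * M / th.
    rewrite -gx mulr_sumr mulr_suml -big_split; apply: eq_bigr => a _ /=.
    by rewrite /xup; ring.
  by rewrite tM {1}sE intrD; field.
have ddn : \sum_a (gamma a)%:~R * xdn a = T%:R * (Num.floor s)%:~R.
  have -> : \sum_a (gamma a)%:~R * xdn a = T%:R * s - t * M / (1 - th).
    rewrite -gx mulr_sumr mulr_suml -sumrN -big_split; apply: eq_bigr => a _ /=.
    by rewrite /xdn; ring.
  by rewrite tM {1}sE; field.
(* With weights [th] and [1 - th] the two displacements cancel. *)
have pE : p = conv (Itv01 (ltW th0) (ltW th1))
    (pesp_point_of xup : convex_lmodType _) (pesp_point_of xdn).
  rewrite -pesp_point_of_conv {1}(pesp_point_of_fst cp); congr pesp_point_of.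
  by apply/funext => a; rewrite /xup /xdn /=; field; rewrite th0' th1'.
(* Both endpoints are generators of the hull, so every convex [C] containing the generators contains
   [p]. *)
move=> C [Cconv CP]; rewrite pE; apply/set_mem; apply: Cconv; apply/mem_set/CP.
  split; first by rewrite pesp_mip_polyhedron; exact: pesp_point_ofP.
  by rewrite (pesp_point_of_dot gE bup) dup mulrAC divff // mul1r intr_int.
split; first by rewrite pesp_mip_polyhedron; exact: pesp_point_ofP.
by rewrite (pesp_point_of_dot gE bdn) ddn mulrAC divff // mul1r intr_int.
Qed.

End FlipSplit.

(** * Equivalence of the two families and equality of the closures *)

Theorem theorem3p1 (R : realType) (I : pesp R)
    (Gamma : 'I_(cyclomatic I) -> {ffun darc I -> int})
    (Gamma_basis : integral_cycle_basis Gamma) :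
  [/\ (forall (gamma : {ffun darc I -> int}) (F : {set darc I}),
         cycle_space gamma -> flip_alpha gamma F <> 0%R ->
         exists lambda : {ffun mip_row (pesp_mip Gamma) -> R},
           split_multiplier (pesp_mip Gamma) lambda /\
           positive_multiple (cycle_periodic Gamma)
             (flip_ineq gamma F) (split_ineq (pesp_mip Gamma) lambda)),
      (forall lambda : {ffun mip_row (pesp_mip Gamma) -> R},
         split_multiplier (pesp_mip Gamma) lambda ->
         exists (gamma : {ffun darc I -> int}) (F : {set darc I}),
           [/\ cycle_space gamma, flip_alpha gamma F <> 0%R &
               positive_multiple (cycle_periodic Gamma)
                 (split_ineq (pesp_mip Gamma) lambda) (flip_ineq gamma F)])
    & split_closure (pesp_mip Gamma) = flip_polytope Gamma].
Proof.
(* This is the positive factor in one direction, and its inverse is the one in the other. *)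
have coef_gt0 (gamma : {ffun darc I -> int}) F : flip_alpha gamma F <> 0 ->
    0 < (flip_alpha gamma F)%:~R * ((period I)%:R - (flip_alpha gamma F)%:~R) :> R.
  move=> /eqP a0; apply: mulr_gt0; last by rewrite subr_gt0 flip_alpha_lt.
  by rewrite lt_neqAle flip_alpha_ge0 eq_sym intr_eq0 a0.
split.
- move=> gamma F /(basis_combination Gamma_basis)[c gE] a0.
  exists (flip_multiplier Gamma c gamma F); split; first exact: flip_multiplierP.
  exists ((flip_alpha gamma F)%:~R * ((period I)%:R - (flip_alpha gamma F)%:~R)).
    exact: coef_gt0.
  split=> [|p cp]; first by rewrite /= mulr1.
  by apply: flip_split_multiple => // a; rewrite ffunE.
- move=> lambda ml; have [gamma [F [cyc lu ll]]] := split_multiplier_flip Gamma_basis ml.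
  (* [lambda b] is non-integral exactly when [alpha] is non-zero. *)
  have a0 : flip_alpha gamma F <> 0.
    by case: ml => _ _ + _; rewrite (split_rhs_flip_int lu ll) => /eqP.
  exists gamma, F; split=> //.
  have c0 := coef_gt0 _ _ a0.
  exists ((flip_alpha gamma F)%:~R * ((period I)%:R - (flip_alpha gamma F)%:~R))^-1.
    by rewrite invr_gt0.
  split=> [|p cp]; first by rewrite /= mulVf ?gt_eqF.
  by rewrite (flip_split_multiple lu ll a0 cp) mulKf ?gt_eqF.
- by apply/seteqP; split; [exact: split_sub_flip | exact: flip_sub_split].
Qed.
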